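(* Let $d\in\mathbb{N}$, $g\in L^2(\mathbb{R}^d/\mathbb{Z}^d)^d$, and let $a\in L^\infty(\mathbb{R}^d/\mathbb{Z}^d)^{d\times d}$ be a symmetric-matrix-valued coefficient field such that, for constants $\lambda,\Lambda>1$, $\lambda^{-1}|\xi|^2\le\xi\cdot a(x)\xi\le\Lambda|\xi|^2$ for all $\xi\in\mathbb{R}^d$ and all $x$. Let $\nabla u$ be the minimizer of $\mathcal{J}(\psi)=\frac12\int\psi\cdot a\psi+\int\psi\cdot g$ over the gradient fields $\{\nabla v:v\in H^1(\mathbb{R}^d/\mathbb{Z}^d)\}$, and assume $\nabla u\ne0$. Let $\phi\in L^2(\mathbb{R}^d/\mathbb{Z}^d)^d$ be given, and define $$E_P[\phi]:=\frac{\|P\phi\|_2}{\|\nabla u\|_2},\qquad E_\Gamma[\phi]:=\frac{\|\Gamma(a\phi+g)\|_2}{\|\nabla u\|_2}.$$ Then we have the upper estimate $$\frac{\|\nabla u-\phi\|_2}{\|\nabla u\|_2}\le(1+\lambda\Lambda)E_P[\phi]+\lambda E_\Gamma[\phi]=:E_{\max}[\phi],$$ and the lower estimate $$\frac{\|\nabla u-\phi\|_2}{\|\nabla u\|_2}\ge\max\Big(E_P[\phi];\frac{1}{\Lambda\sqrt2}E_\Gamma[\phi]\Big)=:E_{\min}[\phi]\ge\frac{1}{2\sqrt2(1+\lambda\Lambda)}E_{\max}[\phi].$$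
   Context: All integrals are over the unit periodic cube $\mathbb{R}^d/\mathbb{Z}^d$ and $\|\cdot\|_2$ is the $L^2$ norm there. $\Gamma:=-\nabla\Delta^{-1}\nabla\cdot$ and $P:=\mathrm{Id}+\Gamma$. $P$ is the Helmholtz–Leray projector: the orthogonal projector of $L^2(\mathbb{R}^d/\mathbb{Z}^d)^d$ onto the divergence-free fields, with Fourier symbol $\hat p_{ij}(k)=\delta_{ij}-k_ik_j/|k|^2$ for $k\in(2\pi\mathbb{Z})^d\setminus\{0\}$ and $\hat p_{ij}(0)=\delta_{ij}$; thus $-\Gamma=\mathrm{Id}-P$ is the orthogonal projector onto the gradient fields $\{\nabla v:v\in H^1(\mathbb{R}^d/\mathbb{Z}^d)\}$. *)

(* Defs.v *)
From HB Require Import structures.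
From mathcomp Require Import all_boot all_order all_algebra.
From mathcomp Require Import all_classical all_reals all_analysis.

Set Implicit Arguments.
Unset Strict Implicit.
Unset Printing Implicit Defensive.

Import Order.TTheory GRing.Theory Num.Theory.
Import numFieldNormedType.Exports.

Local Open Scope classical_set_scope.
Local Open Scope ring_scope.

(* The torus R^d/Z^d is represented by its fundamental domain [0,1)^d inside  *)
(* R^d (d-tuples of reals, with the library's product sigma-algebra), carrying *)
(* the d-dimensional Lebesgue measure of [0,1)^d. A function on the torus is   *)
(* a function on R^d of which only the restriction to [0,1)^d matters.         *)
Section torus_measure.
Context (R : realType).

Definition unit_interval_measure : set (measurableTypeR R) -> \bar R :=
  mrestr (@lebesgue_measure R) (measurable_itv `[0, 1[).

HB.instance Definition _ := Measure.on unit_interval_measure.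

Lemma unit_interval_measureT : unit_interval_measure setT = 1%E.
Proof.
rewrite /unit_interval_measure /mrestr setTI lebesgue_measure_itv/=.
by rewrite lte_fin ltr01 oppr0 adde0.
Qed.

HB.instance Definition _ :=
  Measure_isProbability.Build _ _ _ unit_interval_measure unit_interval_measureT.

Definition cons_tuple_of_pair n (x : measurableTypeR R * n.-tuple (measurableTypeR R)) :
  n.+1.-tuple (measurableTypeR R) := [the n.+1.-tuple _ of x.1 :: x.2].

Lemma measurable_cons_tuple_of_pair n :
  measurable_fun [set: measurableTypeR R * n.-tuple (measurableTypeR R)]
    (@cons_tuple_of_pair n).
Proof. exact: measurable_cons. Qed.

HB.instance Definition _ n := isMeasurableFun.Build _ _ _ _
  (@cons_tuple_of_pair n) (@measurable_cons_tuple_of_pair n).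

Fixpoint torus_measure (d : nat) :
    probability (d.-tuple (measurableTypeR R)) R :=
  match d with
  | 0 => dirac ([tuple] : 0.-tuple (measurableTypeR R))
  | n.+1 => distribution (unit_interval_measure \x torus_measure n)%E
                         (@cons_tuple_of_pair n)
  end.

End torus_measure.

Notation torus_point R d := (d.-tuple (measurableTypeR R)).

Section torus_fields.
Context (R : realType) (d : nat).

Local Notation mu := (torus_measure R d).
Local Notation scalar_field := (torus_point R d -> R).
Local Notation vector_field := (torus_point R d -> 'cV[R]_d).
Local Notation matrix_field := (torus_point R d -> 'M[R]_d).

Definition unit_cube : set (torus_point R d) :=
  [set x | forall i : 'I_d, 0 <= (tnth x i : R) < 1].

Definition dot (u v : 'cV[R]_d) : R := \sum_(i < d) u i 0 * v i 0.

Definition L2_scalar (v : scalar_field) : Prop := v \in Lfun mu 2%:E.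

Definition L2_vector (f : vector_field) : Prop :=
  forall i : 'I_d, (fun x => f x i 0) \in Lfun mu 2%:E.

Definition Linfty_matrix (a : matrix_field) : Prop :=
  forall i j : 'I_d, (fun x => a x i j) \in Lfun mu +oo%E.

Definition mulf (a : matrix_field) (f : vector_field) : vector_field :=
  fun x => a x *m f x.

Definition inner (f g : vector_field) : R := \int[mu]_x dot (f x) (g x).

Definition norm2 (f : vector_field) : R := Num.sqrt (inner f f).

Fixpoint of_class_C (n : nat) (eta : 'rV[R]_d -> R) : Prop :=
  match n with
  | 0 => continuous eta
  | m.+1 => continuous eta /\
      forall j : 'I_d, (forall x, derivable eta x (delta_mx 0 j)) /\
                       of_class_C m (fun x => 'D_(delta_mx 0 j) eta x)
  end.

Definition test_function (eta : 'rV[R]_d -> R) : Prop :=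
  (forall n, of_class_C n eta) /\
  (forall (x : 'rV[R]_d) (k : 'rV[int]_d), eta (x + map_mx intr k) = eta x).

Definition coords (x : torus_point R d) : 'rV[R]_d := \row_(j < d) (tnth x j : R).

(* v is in H^1 of the torus and f is its gradient. The test functions being   *)
(* periodic, there is no boundary term and jumps across the faces of the cube *)
(* are excluded.                                                              *)
Definition is_gradient_of (v : scalar_field) (f : vector_field) : Prop :=
  [/\ L2_scalar v, L2_vector f &
      forall (eta : 'rV[R]_d -> R) (j : 'I_d), test_function eta ->
        \int[mu]_x (v x * 'D_(delta_mx 0 j) eta (coords x)) =
        - \int[mu]_x (f x j 0 * eta (coords x))].

Definition gradient_field (f : vector_field) : Prop :=
  exists v : scalar_field, is_gradient_of v f.

(* div q = 0 as an element of H^{-1}, the dual of H^1. *)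
Definition divergence_free (q : vector_field) : Prop :=
  forall f : vector_field, gradient_field f -> inner q f = 0.

(* h is (a representative of) the orthogonal projection of f onto the closed  *)
(* subspace of divergence-free fields of L^2.                                 *)
Definition is_leray_projection (f h : vector_field) : Prop :=
  [/\ L2_vector h, divergence_free h &
      forall q : vector_field, L2_vector q -> divergence_free q ->
        inner (f - h) q = 0].

(* The Helmholtz-Leray projector P; the projection is unique up to a null set *)
(* and the choice of a representative is immaterial.                          *)
Definition leray (f : vector_field) : vector_field :=
  xget 0 [set h | is_leray_projection f h].

(* Gamma = - grad Delta^{-1} div, so that P = Id + Gamma:                     *)
(* leray_projection_poisson below shows that, if w in H^1 solves              *)
(* Delta w = div f, then the projection of f is f - grad w.                   *)
Definition Gamma (f : vector_field) : vector_field := leray f - f.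

Lemma leray_projection_poisson (f p : vector_field) (w : scalar_field) :
  L2_vector f -> is_gradient_of w p -> divergence_free (f - p) ->
  is_leray_projection f (f - p).
Proof.
move=> Lf wp divfp; split=> // [i|q Lq divq].
  have [_ Lp _] := wp.
  have -> : (fun x => (f - p) x i 0) = (fun x => f x i 0) - (fun x => p x i 0).
    by apply/funext => x; rewrite !fctE !mxE.
  by apply: rpredB; rewrite ?lee1n//.
rewrite opprB addrC subrK -[RHS](divq p); last by exists w.
by apply: eq_Rintegral => x _; apply: eq_bigr => i _; rewrite mulrC.
Qed.

Definition elliptic (a : matrix_field) (lambda Lambda : R) : Prop :=
  forall x, unit_cube x ->
    (a x)^T = a x /\
    forall xi : 'cV[R]_d,
      lambda^-1 * dot xi xi <= dot xi (a x *m xi) <= Lambda * dot xi xi.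

Definition energy (a : matrix_field) (g psi : vector_field) : R :=
  2^-1 * inner psi (mulf a psi) + inner psi g.

Definition is_minimizer (a : matrix_field) (g gradu : vector_field) : Prop :=
  gradient_field gradu /\
  forall psi, gradient_field psi -> energy a g gradu <= energy a g psi.

Section estimators.
Variables (a : matrix_field) (g gradu phi : vector_field) (lambda Lambda : R).

Definition rel_err : R := norm2 (gradu - phi) / norm2 gradu.

Definition E_P : R := norm2 (leray phi) / norm2 gradu.

Definition E_Gamma : R := norm2 (Gamma (mulf a phi + g)) / norm2 gradu.

Definition E_max : R := (1 + lambda * Lambda) * E_P + lambda * E_Gamma.

Definition E_min : R := Num.max E_P ((Lambda * Num.sqrt 2)^-1 * E_Gamma).

End estimators.

End torus_fields.

(* Main.v *)
Require Import Defs.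
From mathcomp Require Import all_boot all_order all_algebra.
From mathcomp Require Import all_classical all_reals all_analysis.
From mathcomp Require Import measurable_realfun ess_sup_inf.
From mathcomp Require Import ring lra.

Import Order.TTheory GRing.Theory Num.Theory.
Import numFieldNormedType.Exports.

Local Open Scope classical_set_scope.
Local Open Scope ring_scope.

Set Implicit Arguments.
Unset Strict Implicit.
Unset Printing Implicit Defensive.

(** Write e = grad u - phi and split it orthogonally as e = e_G - P phi, where P phi is
    divergence-free and e_G = grad u - (phi - P phi) is orthogonal to all divergence-free
    fields. Minimality of grad u says that a grad u + g is divergence-free
    ([minimizer_residual_orthogonal]), so Gamma (a phi + g) is the part of a e orthogonal
    to the divergence-free fields.

    The lower estimate follows: |P phi| <= |e| by Pythagoras, and
    |Gamma (a phi + g)| <= |a e| <= Lambda |e| as projections do not increase norms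
    ([projection_norm_le_error], [residual_norm_le_error]). For the upper estimate,
    ellipticity gives
      lambda^-1 |e_G|^2 <= (e_G, a e_G) = (e_G, Gamma (a phi + g)) + (e_G, a P phi)
                        <= |e_G| (|Gamma (a phi + g)| + Lambda |P phi|),
    and |e| <= |e_G| + |P phi| ([error_le]). Comparing the two bounds is elementary
    ([estimates_of_norm_bounds]). These steps use only a symmetric, elliptic operator on
    a space with a semi-inner product, and are carried out there.

    The analytic content is that the objects exist and that the abstract setting
    applies. The projection on the divergence-free fields, an orthogonal complement,
    exists ([projection_exists], [leray_is_projection]) because L2 is complete
    ([inner_complete]). The first variation of the energy requires gradient fields to
    form a subspace ([gradient_field_linear]). Ellipticity on the cube can be
    integrated because the cube carries the whole measure
    ([torus_measure_unit_cube]). *)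

(** * Semi-inner products *)

Lemma discriminant_le0 (R : realFieldType) (x b c : R) : 0 <= c ->
  (forall t, 0 <= x - 2 * t * b + t ^+ 2 * c) -> b ^+ 2 <= x * c.
Proof.
move=> c0 h; have x0 : 0 <= x by have := h 0; lra.
have [c1|] := ltP 0 c.
  have := h (b / c); rewrite -(ler_pM2l c1).
  have -> : c * (x - 2 * (b / c) * b + (b / c) ^+ 2 * c) = x * c - b ^+ 2.
    by field; rewrite gt_eqF.
  by rewrite mulr0 subr_ge0.
move=> c1; have {c1 c0} c0 : c = 0 by apply/eqP; rewrite eq_le c1 c0.
subst c; have [->|b0] := eqVneq b 0; first by rewrite expr0n mulr0.
(* The affine function of t that remains takes the value -1 there. *)
have := h ((x + 1) / (2 * b)).
have -> : 2 * ((x + 1) / (2 * b)) * b = x + 1 by field.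
lra.
Qed.

Lemma geometric_le0 (R : realType) (x c : R) :
  (forall n, x <= c * 4^-1 ^+ n) -> x <= 0.
Proof.
move=> h.
have : (fun n => c * 4^-1 ^+ n) @ \oo --> (c * 0 : R).
  by apply: cvgMr; apply: cvg_expr; rewrite ger0_norm// invf_lt1// ltr1n.
rewrite mulr0 => h0; rewrite -(cvg_lim _ h0)//.
by apply: limr_ge; [apply/cvg_ex; exists 0|near=> n; exact: h].
Unshelve. all: by end_near. Qed.

(** Everything is relative to a set [L] of vectors, because the space of all vector
    fields contains fields whose products are not integrable; and [ip] need not be
    definite, because fields are not identified when they agree almost everywhere. *)
Record semi_inner (R : realType) (V : lmodType R) (L : set V)
    (ip : V -> V -> R) : Prop := SemiInner {
  semi_innerD : forall u v, L u -> L v -> L (u + v);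
  semi_innerZ : forall c u, L u -> L (c *: u);
  ipC : forall u v, L u -> L v -> ip u v = ip v u;
  ipDl : forall u v w, L u -> L v -> L w -> ip (u + v) w = ip u w + ip v w;
  ipZl : forall c u w, L u -> L w -> ip (c *: u) w = c * ip u w;
  ip_ge0 : forall u, L u -> 0 <= ip u u }.

Section semi_inner_theory.
Context (R : realType) (V : lmodType R) (L : set V) (ip : V -> V -> R).
Hypothesis H : semi_inner L ip.
Implicit Types u v w : V.

Lemma semi_innerN u : L u -> L (- u).
Proof. by rewrite -scaleN1r; exact: (semi_innerZ H). Qed.

Lemma semi_innerB u v : L u -> L v -> L (u - v).
Proof. by move=> Lu Lv; apply: (semi_innerD H) => //; exact: semi_innerN. Qed.

Lemma ipNl u w : L u -> L w -> ip (- u) w = - ip u w.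
Proof. by move=> Lu Lw; rewrite -scaleN1r (ipZl H)// mulN1r. Qed.

Lemma ipBl u v w : L u -> L v -> L w -> ip (u - v) w = ip u w - ip v w.
Proof.
by move=> Lu Lv Lw; rewrite (ipDl H)//; [rewrite ipNl|exact: semi_innerN].
Qed.

Lemma ipDr u v w : L u -> L v -> L w -> ip w (u + v) = ip w u + ip w v.
Proof.
move=> Lu Lv Lw; rewrite (ipC H)//; last exact: (semi_innerD H).
by rewrite (ipDl H)// !(ipC H Lw).
Qed.

Lemma ipZr c u w : L u -> L w -> ip w (c *: u) = c * ip w u.
Proof.
move=> Lu Lw; rewrite (ipC H)//; last exact: (semi_innerZ H).
by rewrite (ipZl H)// (ipC H Lw).
Qed.

Lemma ipBr u v w : L u -> L v -> L w -> ip w (u - v) = ip w u - ip w v.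
Proof.
move=> Lu Lv Lw; rewrite (ipC H)//; last exact: semi_innerB.
by rewrite ipBl// !(ipC H Lw).
Qed.

Lemma ip_sqrD u v : L u -> L v -> ip (u + v) (u + v) = ip u u + 2 * ip u v + ip v v.
Proof.
move=> Lu Lv; have Luv := semi_innerD H Lu Lv.
rewrite ipDr// !(ipDl H)// (ipC H Lv Lu)//; ring.
Qed.

Lemma ip_sqrZ c u : L u -> ip (c *: u) (c *: u) = c ^+ 2 * ip u u.
Proof.
move=> Lu; have Lcu := semi_innerZ H c Lu.
by rewrite ipZr// (ipZl H)//; ring.
Qed.

Lemma ip_sqrB u v : L u -> L v -> ip (u - v) (u - v) = ip u u - 2 * ip u v + ip v v.
Proof.
move=> Lu Lv; have Luv := semi_innerB Lu Lv.
rewrite ipBr// !ipBl// (ipC H Lv Lu)//; ring.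
Qed.

Lemma cauchy_schwarz_sqr u v : L u -> L v -> ip u v ^+ 2 <= ip u u * ip v v.
Proof.
move=> Lu Lv; apply: discriminant_le0 (ip_ge0 H Lv) _ => t.
have Ltv := semi_innerZ H t Lv.
have := ip_ge0 H (semi_innerB Lu Ltv).
by rewrite ip_sqrB// ip_sqrZ// ipZr// mulrA.
Qed.

Definition ip_norm u := Num.sqrt (ip u u).

Lemma ip_norm_sqr u : L u -> ip_norm u ^+ 2 = ip u u.
Proof. by move=> Lu; rewrite /ip_norm sqr_sqrtr// (ip_ge0 H). Qed.

Lemma cauchy_schwarz u v : L u -> L v -> ip u v <= ip_norm u * ip_norm v.
Proof.
move=> Lu Lv; apply: le_trans (ler_norm _) _.
rewrite -sqrtrM ?(ip_ge0 H)// -sqrtr_sqr ler_wsqrtr//.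
exact: cauchy_schwarz_sqr.
Qed.

Lemma ip_norm_ge0 u : 0 <= ip_norm u. Proof. exact: sqrtr_ge0. Qed.

Lemma ip_norm_triangle u v : L u -> L v -> ip_norm (u - v) <= ip_norm u + ip_norm v.
Proof.
move=> Lu Lv.
rewrite -[leRHS]ger0_norm ?addr_ge0 ?ip_norm_ge0// -sqrtr_sqr ler_wsqrtr//.
rewrite ip_sqrB// sqrrD !ip_norm_sqr// lerD2r lerD2l.
have := cauchy_schwarz (semi_innerN Lu) Lv; rewrite ipNl//.
rewrite [ip_norm (- u)]/ip_norm -scaleN1r ip_sqrZ// sqrrN expr1n mul1r -/(ip_norm u).
rewrite -mulr_natl; lra.
Qed.

End semi_inner_theory.

(** * Orthogonal projection *)

(** Sequences with geometrically small increments suffice: every Cauchy sequence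
    has such a subsequence. The rate 4^-1 is for squared norms, so that the norms
    themselves decay like 2^-1. *)
Definition ip_complete (R : realType) (V : lmodType R) (L : set V)
    (ip : V -> V -> R) := forall q : nat -> V, (forall n, L (q n)) ->
  (forall n m, (n <= m)%N -> ip (q m - q n) (q m - q n) <= 4^-1 ^+ n) ->
  exists2 h, L h & forall n, ip (h - q n) (h - q n) <= 4^-1 ^+ n.

Definition orth_compl (R : realType) (V : lmodType R) (L G : set V)
  (ip : V -> V -> R) : set V := [set q | L q /\ forall f, G f -> ip q f = 0].

(** A sequence [q n] in the orthogonal complement that minimizes the distance to [f]
    up to 4^-1 ^+ n.+1 has geometrically small increments, by the parallelogram
    identity at the midpoint of [q m] and [q n], which costs a factor 4, and its limit is the projection.
    Near-minimality makes [f - q n] nearly orthogonal to the complement: the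
    discriminant of the squared distance along a line bounds the defect by the
    excess, which tends to zero. *)
Lemma projection_exists (R : realType) (V : lmodType R) (L G : set V)
    (ip : V -> V -> R) : semi_inner L ip -> ip_complete L ip ->
  (G `<=` L)%classic ->
  forall f, L f -> exists2 h, orth_compl L G ip h &
    forall q, orth_compl L G ip q -> ip (f - h) q = 0.
Proof.
move=> H cpl GL f Lf; set D := orth_compl L G ip.
have DL : (D `<=` L)%classic by move=> ? [].
have DD u v : D u -> D v -> D (u + v).
  move=> [Lu u0] [Lv v0]; split; first exact: (semi_innerD H).
  by move=> w Gw; rewrite (ipDl H)//; [rewrite u0// v0// addr0|exact: GL].
have DZ c u : D u -> D (c *: u).
  move=> [Lu u0]; split; first exact: (semi_innerZ H).
  by move=> w Gw; rewrite (ipZl H)//; [rewrite u0// mulr0|exact: GL].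
pose S := [set ip (f - q) (f - q) | q in D]%classic.
have D0 : D 0.
  split=> [|w Gw]; first by rewrite -(scale0r f); exact: (semi_innerZ H).
  by rewrite -(scale0r f) (ipZl H)// ?mul0r//; exact: GL.
have S_inf : has_inf S.
  split; first by exists (ip (f - 0) (f - 0)), 0.
  exists 0 => _ [q Dq <-]; apply: (ip_ge0 H); apply: (semi_innerB H) => //.
  exact: DL.
pose del := inf S.
have del_le q : D q -> del <= ip (f - q) (f - q).
  by move=> Dq; apply: ge_inf; [exact: S_inf.2|exists q].
have /choice[q qP] n : exists q, D q /\ ip (f - q) (f - q) < del + 4^-1 ^+ n.+1.
  have e0 : 0 < (4^-1 : R) ^+ n.+1 by rewrite exprn_gt0.
  have [_ [q Dq <-] qlt] := inf_adherent e0 S_inf.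
  by exists q.
have Lq n : L (q n) by apply: DL; exact: (qP n).1.
have Lfq n : L (f - q n) by exact: (semi_innerB H).
have [|n m nm|h Lh hq] := cpl q.
- by move=> n; exact: Lq.
- have Dmid : D (2^-1 *: (q m + q n)).
    by apply: DZ; apply: DD; [exact: (qP m).1|exact: (qP n).1].
  have := del_le _ Dmid.
  have -> : f - 2^-1 *: (q m + q n) = 2^-1 *: ((f - q m) + (f - q n)).
    have half : 2^-1 + 2^-1 = 1 :> R by lra.
    by rewrite addrACA -opprD scalerBr [2^-1 *: (f + f)]scalerDr -scalerDl half scale1r.
  rewrite (ip_sqrZ H); last by apply: (semi_innerD H).
  have -> : q m - q n = (f - q n) - (f - q m) by rewrite opprB [RHS]addrC addrA subrK.
  rewrite (ip_sqrD H (Lfq m) (Lfq n)) (ip_sqrB H (Lfq n) (Lfq m)) (ipC H (Lfq n) (Lfq m)).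
  have := (qP n).2; have := (qP m).2.
  have : 4^-1 ^+ m.+1 <= 4^-1 ^+ n.+1 :> R.
    by rewrite ler_wiXn2l// invf_le1// ler1n.
  by rewrite !(exprS _ n); lra.
have Lhq n : L (h - q n) by exact: (semi_innerB H).
have sqr0 (x : R) : x ^+ 2 <= 0 -> x = 0.
  by move=> x0; apply/eqP; rewrite -sqrf_eq0 eq_le x0 sqr_ge0.
exists h => [|v Dv].
- split=> // w Gw; have Lw := GL _ Gw; apply: sqr0.
  apply: (@geometric_le0 _ _ (ip w w)) => n.
  have -> : ip h w = ip (h - q n) w.
    by rewrite (ipBl H)// ((qP n).1.2 _ Gw) subr0.
  apply: le_trans (cauchy_schwarz_sqr H _ _) _ => //.
  by rewrite mulrC ler_wpM2l// (ip_ge0 H).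
have Lv := DL _ Dv; apply: sqr0.
apply: (@geometric_le0 _ _ (4 * ip v v)) => n.
have -> : f - h = (f - q n) - (h - q n) by rewrite opprB addrA subrK.
rewrite (ipBl H)//.
have A1 : ip (h - q n) v ^+ 2 <= 4^-1 ^+ n * ip v v.
  apply: le_trans (cauchy_schwarz_sqr H _ _) _ => //.
  by rewrite ler_wpM2r// (ip_ge0 H).
have A2 : ip (f - q n) v ^+ 2 <= 4^-1 ^+ n.+1 * ip v v.
  apply: discriminant_le0; first exact: (ip_ge0 H).
  move=> t; have Ltv := semi_innerZ H t Lv.
  have Dqt : D (q n + t *: v) by apply: DD; [exact: (qP n).1|exact: DZ].
  have := del_le _ Dqt; rewrite opprD addrA (ip_sqrB H)// (ip_sqrZ H)// (ipZr H)//.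
  by have := (qP n).2; lra.
move: A1 A2; rewrite (exprS _ n); move: (4^-1 ^+ n) (ip v v) (ip_ge0 H Lv) => e x x0.
move: (ip _ v) (ip _ v) => y z; have := sqr_ge0 (y + z); nra.
Qed.

(** * Error estimates *)

(** The weak Euler-Lagrange equation. Along the line through [u] directed by [f] the
    energy is a quadratic polynomial with minimum at [u]; its discriminant is the
    square of the first variation, so the latter vanishes. *)
Lemma minimizer_residual_orthogonal (R : realType) (V : lmodType R) (L G : set V)
    (ip : V -> V -> R) (A : V -> V) (g u : V) : semi_inner L ip ->
  semi_inner L (fun v w => ip v (A w)) -> (forall v, L v -> L (A v)) ->
  G `<=` L -> (forall c v w, G v -> G w -> G (v + c *: w)) ->
  L g -> G u ->
  (forall v, G v -> 2^-1 * ip u (A u) + ip u g <= 2^-1 * ip v (A v) + ip v g) ->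
  orth_compl L G ip (A u + g).
Proof.
move=> H HA LA GL Glin Lg Gu umin; have Lu := GL _ Gu.
have LAu := LA _ Lu; split; first exact: (semi_innerD H).
move=> f Gf; have Lf := GL _ Gf.
rewrite (ipDl H)// (ipC H LAu Lf) (ipC H Lg Lf).
set b := _ + _; apply/eqP; rewrite -sqrf_eq0 eq_le sqr_ge0 andbT.
have -> : 0 = 0 * (2 * ip f (A f)) by rewrite mul0r.
apply: discriminant_le0 => [|t].
  by rewrite mulr_ge0// (ip_ge0 HA).
have Lt := semi_innerZ H (- (2 * t)) Lf.
have := umin _ (Glin (- (2 * t)) _ _ Gu Gf).
have /= -> := ip_sqrD HA Lu Lt; have /= -> := ip_sqrZ HA (- (2 * t)) Lf.
have /= -> := ipZr HA (- (2 * t)) Lf Lu.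
rewrite (ipDl H)// (ipZl H)// /b; have /= -> := ipC HA Lu Lf; lra.
Qed.

(** The form bound becomes a norm bound through the Cauchy-Schwarz inequality of the
    product [ip v (A w)], applied to [A v] and [v]. *)
Lemma ip_norm_le_operator (R : realType) (V : lmodType R) (L : set V)
    (ip : V -> V -> R) (A : V -> V) (Lambda : R) : semi_inner L ip ->
  semi_inner L (fun v w => ip v (A w)) -> (forall v, L v -> L (A v)) ->
  0 <= Lambda -> (forall v, L v -> ip v (A v) <= Lambda * ip v v) ->
  forall v, L v -> ip_norm ip (A v) <= Lambda * ip_norm ip v.
Proof.
move=> H HA LA Lam0 upper v Lv; have LAv := LA _ Lv.
have := cauchy_schwarz_sqr HA LAv Lv; rewrite -/(ip _ _).
have := upper _ LAv; have := upper _ Lv; have := ip_ge0 HA Lv; have := ip_ge0 HA LAv.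
rewrite -!(ip_norm_sqr H)//.
move: (ip_norm_ge0 ip v) (ip_norm_ge0 ip (A v)).
move: (ip_norm ip v) (ip_norm ip (A v)) (ip _ _) (ip _ _) => y x p q y0 x0 p0 q0 qy px h.
have h1 : (x ^+ 2) ^+ 2 <= (Lambda * x ^+ 2) * (Lambda * y ^+ 2).
  by apply: le_trans h _; apply: ler_pM.
have [->|xN0] := eqVneq x 0; first by rewrite mulr_ge0.
have x1 : 0 < x by rewrite lt_neqAle eq_sym xN0.
rewrite -(@ler_pXn2r _ 2) ?nnegrE ?mulr_ge0//.
rewrite -(ler_pM2l (exprn_gt0 2 x1)) -[leLHS]expr2 (le_trans h1)//.
by rewrite le_eqVlt; apply/orP; left; apply/eqP; ring.
Qed.

(** Here [h] is the projection of [phi] on the orthogonal complement [D] of [G] (the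
    divergence-free fields), [k] that of [A phi + g], so that [k - (A phi + g)] is
    Gamma applied to [A phi + g]. *)
Section error_estimates.
Context (R : realType) (V : lmodType R) (L G : set V) (ip : V -> V -> R).
Context (A : V -> V) (lambda Lambda : R) (g u phi h k : V).
Hypothesis H : semi_inner L ip.
Hypothesis HA : semi_inner L (fun v w => ip v (A w)).
Hypothesis LA : forall v, L v -> L (A v).
Hypothesis AB : forall v w, L v -> L w -> A (v - w) = A v - A w.
Hypotheses (lambda_gt0 : 0 < lambda) (Lambda_ge0 : 0 <= Lambda).
Hypothesis lower : forall v, L v -> lambda^-1 * ip v v <= ip v (A v).
Hypothesis upper : forall v, L v -> ip v (A v) <= Lambda * ip v v.
Hypothesis GL : G `<=` L.
Hypotheses (Lg : L g) (Gu : G u) (Lphi : L phi).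
Local Notation D := (orth_compl L G ip).
Local Notation N := (ip_norm ip).
Hypothesis residual : D (A u + g).
Hypotheses (Dh : D h) (Dk : D k).
Hypothesis h_proj : forall q, D q -> ip (phi - h) q = 0.
Hypothesis k_proj : forall q, D q -> ip (A phi + g - k) q = 0.

Let Lu : L u. Proof. exact: GL. Qed.
Let Lh : L h. Proof. exact: Dh.1. Qed.
Let Lk : L k. Proof. exact: Dk.1. Qed.
Let LB : forall v w, L v -> L w -> L (v - w).
Proof. by move=> v w; exact: (semi_innerB H). Qed.
Let e := u - phi.
Let eG := u - (phi - h).
Let Le : L e. Proof. exact: LB. Qed.
Let LeG : L eG. Proof. by rewrite /eG; do !apply: LB. Qed.
Let r := k - (A phi + g).
Let LAphi : L (A phi + g). Proof. by apply: (semi_innerD H) => //; exact: LA. Qed.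
Let Lr : L r. Proof. exact: LB. Qed.

(* [phi - h] lies in the orthogonal complement of D, which contains G and hence [u]. *)
Let eG_orth q : D q -> ip eG q = 0.
Proof.
move=> Dq; have Lq := Dq.1; rewrite /eG (ipBl H)//; last exact: LB.
by rewrite h_proj// subr0 (ipC H)// Dq.2.
Qed.

Let eE : e = eG - h.
Proof. by rewrite /e /eG opprB addrA addrAC addrK. Qed.

Let N_e : N e ^+ 2 = N eG ^+ 2 + N h ^+ 2.
Proof. by rewrite !(ip_norm_sqr H)// eE (ip_sqrB H)// (eG_orth Dh) mulr0 subr0. Qed.

Let A_e : A e = r + (A u + g - k).
Proof.
rewrite /e AB// /r.
by rewrite [RHS]addrC addrA subrK opprD addrACA subrr addr0.
Qed.

Let Dq0 : D (A u + g - k).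
Proof.
split; first by apply: LB => //; exact: residual.1.
move=> f Gf; have Lf := GL Gf; rewrite (ipBl H)//; last exact: residual.1.
by rewrite residual.2// Dk.2// subr0.
Qed.

(* As [A u + g] lies in D, this [r] is the part of [A e] orthogonal to D. *)
Let r_orth q : D q -> ip r q = 0.
Proof.
move=> Dq; have := k_proj Dq; have Lq := Dq.1.
by rewrite /r !(ipBl H)// => /eqP; rewrite subr_eq0 => /eqP ->; rewrite subrr.
Qed.

(** Pythagoras: [h] is the component of the error in D, up to sign. *)
Lemma projection_norm_le_error : N h <= N e.
Proof.
rewrite -(@ler_pXn2r _ 2) ?nnegrE ?ip_norm_ge0// N_e lerDr sqr_ge0//.
Qed.

(** The residual [r] is a projection of [A e], hence no longer than it. *)
Lemma residual_norm_le_error : N r <= Lambda * N e.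
Proof.
apply: le_trans (ip_norm_le_operator H HA LA Lambda_ge0 upper Le).
rewrite -(@ler_pXn2r _ 2) ?nnegrE ?ip_norm_ge0//.
rewrite !(ip_norm_sqr H)//; last exact: LA.
rewrite A_e (ip_sqrD H)//; last exact: Dq0.1.
by rewrite (r_orth Dq0) mulr0 addr0 lerDl (ip_ge0 H)//; exact: Dq0.1.
Qed.

(** Coercivity on the gradient part [eG] of the error: since [A eG = A e + A h] and
    [A e] is [r] up to a vector orthogonal to [eG], testing with [eG] bounds its norm
    by lambda (N r + Lambda N h); the other part of the error is [h]. *)
Lemma error_le : N e <= (1 + lambda * Lambda) * N h + lambda * N r.
Proof.
have key : N eG ^+ 2 <= lambda * (N eG * N r + N eG * (Lambda * N h)).
  rewrite -ler_pdivrMl// (ip_norm_sqr H)//.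
  apply: le_trans (lower LeG) _.
  have -> : A eG = r + (A u + g - k) + A h by rewrite -A_e eE AB// subrK.
  have LAh := LA Lh; have LD := semi_innerD H; have Lq := Dq0.1.
  rewrite (ipDr H (LD _ _ Lr Lq) LAh LeG) (ipDr H Lr Lq LeG).
  rewrite (eG_orth Dq0) addr0 lerD ?(cauchy_schwarz H)//.
  apply: le_trans (cauchy_schwarz H LeG LAh) _; rewrite ler_wpM2l ?ip_norm_ge0//.
  exact: (ip_norm_le_operator H HA LA Lambda_ge0 upper).
have : N eG <= lambda * (N r + Lambda * N h).
  have [e0|eN0] := eqVneq (N eG) 0.
    by rewrite e0 mulr_ge0 ?addr_ge0 ?mulr_ge0 ?ip_norm_ge0// ltW.
  have e1 : 0 < N eG by rewrite lt_neqAle eq_sym eN0 ip_norm_ge0.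
  rewrite -(ler_pM2l e1) -[leLHS]expr2 (le_trans key)//.
  by rewrite le_eqVlt; apply/orP; left; apply/eqP; ring.
have := ip_norm_triangle H LeG Lh; rewrite -eE; lra.
Qed.

End error_estimates.

(** * Almost everywhere convergence in L2 *)

Lemma cvg_abs_summable (R : realType) (u : nat -> R) :
  (\sum_(n <oo) `|u n.+1 - u n|%:E)%E \is a fin_num -> cvgn u.
Proof.
move=> S.
have -> : u = (fun n => u 0%N + series (telescope u) n).
  by apply/funext => n; rewrite -eq_sum_telescope.
apply: is_cvgD; first exact: is_cvg_cst.
apply: normed_cvg; apply: nondecreasing_is_cvgn.
  apply/nondecreasing_seqP => n; rewrite [leLHS]/= [leRHS]/=.
  rewrite seriesEnat /= big_nat_recr//=.
  by rewrite lerDl.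
exists (fine (\sum_(n <oo) `|u n.+1 - u n|%:E)%E) => _ [n _ <-].
rewrite -lee_fin fineK// /series/= -sumEFin.
by apply: (@nneseries_lim_ge _ _ xpredT 0) => k _ _; rewrite lee_fin.
Qed.

Section L2_complete.
Context d (T : measurableType d) (R : realType).
Variable mu : probability T R.

(** The total mass being one, increments with squared L2 norm at most 4^-n have L1 norm
    at most 2^-n. The sum of their absolute values is then integrable, hence finite
    almost everywhere. *)
Lemma ae_cvg_of_L2_geometric (f : nat -> T -> R) :
  (forall n, measurable_fun setT (f n)) ->
  (forall n, \int[mu]_x ((f n.+1 x - f n x) ^+ 2)%:E <= (4^-1 ^+ n)%:E)%E ->
  {ae mu, forall x, cvgn (f ^~ x)}.
Proof.
move=> mf fL2.
have mB n : measurable_fun setT (fun x => f n.+1 x - f n x).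
  exact: measurable_funB.
have mB2 n : measurable_fun setT (fun x => (f n.+1 x - f n x) ^+ 2).
  exact: measurable_funX.
have mN n : measurable_fun setT (fun x => `|f n.+1 x - f n x|%:E).
  by apply/measurable_EFinP; exact: measurableT_comp.
have L1 n : (\int[mu]_x `|f n.+1 x - f n x|%:E <= (2 / (2 ^ n.+1)%:R)%:E)%E.
  (* Weighted arithmetic-geometric inequality: |t| <= (c t^2 + 1/c) / 2, c = 2^n. *)
  pose c : R := 2 ^+ n; have c0 : 0 < c by rewrite exprn_gt0.
  apply: (@le_trans _ _ (\int[mu]_x ((2^-1 * c)%:E * ((f n.+1 x - f n x) ^+ 2)%:E
      + (2^-1 * c^-1)%:E))%E).
    apply: ge0_le_integral => //.
    - apply: emeasurable_funD => //; apply: emeasurable_funM => //.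
      exact/measurable_EFinP.
    move=> x _; rewrite -EFinM -EFinD lee_fin.
    move: (f n.+1 x - f n x) => t; rewrite -(real_normK (num_real t)).
    have := sqr_ge0 (c * `|t| - 1); move: `|t| => s h.
    rewrite -(ler_pM2l c0).
    have -> : c * (2^-1 * c * s ^+ 2 + 2^-1 / c) = 2^-1 * (c * s) ^+ 2 + 2^-1.
      by field; rewrite gt_eqF.
    nra.
  rewrite ge0_integralD//; first last.
  - by move=> x _; rewrite lee_fin mulr_ge0// ?invr_ge0 ?ltW.
  - by apply: emeasurable_funM => //; exact/measurable_EFinP.
  - by move=> x _; rewrite -EFinM lee_fin mulr_ge0 ?sqr_ge0// mulr_ge0// ltW.
  rewrite [X in (_ + X)%E](_ : _ = (2^-1 / c)%:E); last first.
    by rewrite integral_cst// -[RHS]mule1; congr (_ * _)%E; exact: probability_setT.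
  rewrite ge0_integralZl_EFin//; first last.
  - by rewrite mulr_ge0// ltW.
  - exact/measurable_EFinP.
  - by move=> x _; rewrite lee_fin sqr_ge0.
  apply: (@le_trans _ _ ((2^-1 * c)%:E * (4^-1 ^+ n)%:E + (2^-1 / c)%:E)%E).
    by rewrite leeD2r// lee_wpmul2l// lee_fin mulr_ge0// ltW.
  rewrite -EFinM -EFinD lee_fin natrX exprS.
  have -> : (4^-1 : R) ^+ n = (c ^+ 2)^-1.
    by rewrite exprVn /c -exprM mulnC exprM; congr (_ ^+ _)^-1; ring.
  by rewrite -/c le_eqVlt; apply/orP; left; apply/eqP; field; rewrite gt_eqF.
have := @integral_nneseries _ _ _ mu setT measurableT _ mN.
move=> /(_ (fun n x _ => normr_ge0 _)) IS.
have Sint : mu.-integrable setT (fun x => \sum_(n <oo) `|f n.+1 x - f n x|%:E)%E.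
  apply/integrableP; split.
    apply: ge0_emeasurable_sum => //.
  under eq_integral do rewrite gee0_abs ?nneseries_ge0//.
  rewrite IS; apply: (@le_lt_trans _ _ 2%:E); last exact: ltry.
  apply: le_trans (epsilon_trick0 xpredT _) => //.
  by apply: lee_nneseries => // n _; rewrite integral_ge0.
apply: filterS (integrable_ae measurableT Sint) => x /(_ I).
exact: cvg_abs_summable.
Qed.

End L2_complete.

(** * Square-integrable scalar fields *)

Section L2_scalar_fields.
Context d (T : measurableType d) (R : realType).
Variable mu : {measure set T -> \bar R}.

Lemma Lfun_measurable (p : \bar R) (f : T -> R) :
  f \in Lfun mu p -> measurable_fun setT f.
Proof. by rewrite inE => /andP[]; rewrite inE. Qed.

Lemma Lfun2P (f : T -> R) : measurable_fun setT f ->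
  (\int[mu]_x (f x ^+ 2)%:E < +oo)%E -> f \in Lfun mu 2%:E.
Proof.
move=> mf fi; rewrite inE; apply/andP; split; rewrite inE//=.
rewrite /finite_norm unlock /= poweR_lty//.
apply: le_lt_trans fi; rewrite le_eqVlt; apply/orP; left; apply/eqP.
apply: eq_integral => x _.
by rewrite -[RHS]gee0_abs ?lee_fin ?sqr_ge0//= powR_mulrn// normrX.
Qed.

Lemma Lfun2D (f g : T -> R) :
  f \in Lfun mu 2%:E -> g \in Lfun mu 2%:E -> (fun x => f x + g x) \in Lfun mu 2%:E.
Proof.
by move=> Lf Lg; have : f + g \in Lfun mu 2%:E by apply: rpredD => //; rewrite lee1n.
Qed.

Lemma Lfun2Z (c : R) (f : T -> R) :
  f \in Lfun mu 2%:E -> (fun x => c * f x) \in Lfun mu 2%:E.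
Proof.
move=> /(Lfun_scale c (ler1n _ 2)).
by rewrite (_ : c \o* f = fun x => c * f x)//; apply/funext => x /=; rewrite mulrC.
Qed.

Lemma Lfun2_sum (n : nat) (f : 'I_n -> T -> R) :
  (forall i, f i \in Lfun mu 2%:E) -> (fun x => \sum_(i < n) f i x) \in Lfun mu 2%:E.
Proof.
move=> Lf; rewrite (_ : (fun _ => _) = \sum_(i < n) f i).
  by apply: rpred_sum => //; rewrite lee1n.
by apply/funext => x; rewrite fct_sumE.
Qed.

Lemma Lfun2M_ae_bounded (M : R) (b f : T -> R) : measurable_fun setT b ->
  {ae mu, forall x, `|b x| <= M} ->
  f \in Lfun mu 2%:E -> (fun x => b x * f x) \in Lfun mu 2%:E.
Proof.
move=> mb bM Lf; have mf := Lfun_measurable Lf.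
have mf2 : measurable_fun setT (fun x => (f x ^+ 2)%:E).
  by apply/measurable_EFinP; exact: measurable_funX.
have /integrableP[_ fi] := Lfun2_integrable_sqr Lf.
apply: Lfun2P; first exact: measurable_funM.
apply: (@le_lt_trans _ _ (\int[mu]_x ((M ^+ 2)%:E * (f x ^+ 2)%:E))%E).
  apply: ae_ge0_le_integral => //.
  - by move=> x _; rewrite lee_fin sqr_ge0.
  - by apply/measurable_EFinP; apply: measurable_funX; exact: measurable_funM.
  - by move=> x _; rewrite -EFinM lee_fin mulr_ge0 ?sqr_ge0.
  - exact: emeasurable_funM.
  apply: filterS bM => x bM _; rewrite -EFinM lee_fin exprMn.
  rewrite ler_wpM2r ?sqr_ge0// -(real_normK (num_real (b x))) lerXn2r ?nnegrE//.
  exact: le_trans bM.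
rewrite ge0_integralZl_EFin ?sqr_ge0//; last by move=> x _; rewrite lee_fin sqr_ge0.
rewrite lte_mul_pinfty ?lee_fin ?sqr_ge0//.
apply: le_lt_trans fi; apply: ge0_le_integral => //.
- by move=> x _; rewrite lee_fin sqr_ge0.
- exact: measurableT_comp.
- by move=> x _; rewrite lee_fin/= ler_norm.
Qed.

Lemma Lfun_infty_ae_bounded (b : T -> R) :
  b \in Lfun mu +oo%E -> exists M, {ae mu, forall x, `|b x| <= M}.
Proof.
rewrite inE => /andP[_]; rewrite inE/= /finite_norm unlock.
case: ifPn => [_ /ess_supr_bounded//|muT _].
(* The norm is set to 0 by convention when the space has measure zero. *)
exists 0; apply: measure0_ae; apply/eqP.
by rewrite eq_le measure_ge0 andbT leNgt.
Qed.

Lemma Lfun2M_integrable (f g : T -> R) :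
  f \in Lfun mu 2%:E -> g \in Lfun mu 2%:E ->
  mu.-integrable setT (fun x => (f x * g x)%:E).
Proof. by move=> Lf Lg; apply/Lfun1_integrable; exact: Lfun2_mul_Lfun1. Qed.

End L2_scalar_fields.

(** * The unit cube has full measure *)

Section unit_cube_full.
Context (R : realType).

Lemma measurable_unit_cube d : measurable (@unit_cube R d).
Proof.
rewrite (_ : @unit_cube R d = \bigcap_(i in [set: 'I_d])
    ((fun x : torus_point R d => tnth x i) @^-1` `[0, 1[)); last first.
  apply/seteqP; split=> x /= h.
    by move=> i _; rewrite /= in_itv/=; exact: h.
  by move=> i; have := h i Logic.I; rewrite /= in_itv.
apply: fin_bigcap_measurable => // i _.
by rewrite -[X in measurable X]setTI; exact: measurable_tnth.
Qed.

Lemma torus_measure_unit_cube d : torus_measure R d (@unit_cube R d) = 1%E.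
Proof.
elim: d => [|d IH].
  rewrite /= diracE mem_set//; by case.
have E : torus_measure R d.+1 (@unit_cube R d.+1) =
   (@unit_interval_measure R \x torus_measure R d)%E (`[0, 1[ `*` @unit_cube R d).
  rewrite /= /pushforward; congr (_ _).
  apply/seteqP; split=> -[x y] /=.
    move=> h; split; first by have := h ord0; rewrite tnth0 in_itv.
    by move=> i; have := h (lift ord0 i); rewrite tnthS.
  rewrite in_itv => -[/= h0 h] i; have [j ->|->] := unliftP ord0 i.
    by rewrite tnthS.
  by rewrite tnth0.
rewrite E product_measure1E//; last exact: measurable_unit_cube.
rewrite [X in (_ * X)%E](_ : _ = 1%E); last exact: IH.
rewrite mule1 /= /unit_interval_measure /mrestr setIid.
by rewrite lebesgue_measure_itv/= lte_fin ltr01 oppr0 adde0.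
Qed.

Lemma torus_measure_unit_cubeC d : torus_measure R d (~` @unit_cube R d) = 0%E.
Proof.
rewrite probability_setC; last exact: measurable_unit_cube.
by rewrite torus_measure_unit_cube subee.
Qed.

Lemma le_Rintegral_unit_cube d (f g : torus_point R d -> R) :
  (torus_measure R d).-integrable setT (EFin \o f) ->
  (torus_measure R d).-integrable setT (EFin \o g) ->
  (forall x, unit_cube x -> f x <= g x) ->
  \int[torus_measure R d]_x f x <= \int[torus_measure R d]_x g x.
Proof.
move=> fi gi fg; have mC := measurableC (@measurable_unit_cube d).
have C0 := torus_measure_unit_cubeC d.
rewrite /Rintegral (negligible_integral _ _ _ C0)// [leRHS](_ : _ =
  fine (\int[torus_measure R d]_(x in setT `\` ~` @unit_cube R d) (g x)%:E)).
  apply: le_Rintegral.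
  - exact: measurableD.
  - by apply: integrableS fi => //; exact: measurableD.
  - by apply: integrableS gi => //; exact: measurableD.
  by move=> x [_ /contrapT]; exact: fg.
by rewrite (negligible_integral _ _ _ C0).
Qed.

Lemma eq_Rintegral_unit_cube d (f g : torus_point R d -> R) :
  (torus_measure R d).-integrable setT (EFin \o f) ->
  (torus_measure R d).-integrable setT (EFin \o g) ->
  (forall x, unit_cube x -> f x = g x) ->
  \int[torus_measure R d]_x f x = \int[torus_measure R d]_x g x.
Proof.
move=> fi gi fg; apply/eqP; rewrite eq_le.
by rewrite !le_Rintegral_unit_cube// => x /fg ->.
Qed.

End unit_cube_full.

(** * The Hilbert space of square-integrable vector fields *)

Section L2_vector_fields.
Context (R : realType) (d : nat).
Local Notation mu := (torus_measure R d).
Implicit Types f g h : torus_point R d -> 'cV[R]_d.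

Lemma dotC (u v : 'cV[R]_d) : dot u v = dot v u.
Proof. by apply: eq_bigr => i _; rewrite mulrC. Qed.

Lemma dotDl (u v w : 'cV[R]_d) : dot (u + v) w = dot u w + dot v w.
Proof. by rewrite -big_split; apply: eq_bigr => i _; rewrite mxE mulrDl. Qed.

Lemma dotZl c (u w : 'cV[R]_d) : dot (c *: u) w = c * dot u w.
Proof. by rewrite mulr_sumr; apply: eq_bigr => i _; rewrite mxE mulrA. Qed.

Lemma dot_ge0 (u : 'cV[R]_d) : 0 <= dot u u.
Proof. by apply: sumr_ge0 => i _; rewrite -expr2 sqr_ge0. Qed.

Lemma sqr_coord_le_dot (u : 'cV[R]_d) i : u i 0 ^+ 2 <= dot u u.
Proof.
rewrite /dot (bigD1 i)//= expr2 lerDl; apply: sumr_ge0 => j _.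
by rewrite -expr2 sqr_ge0.
Qed.

Lemma dot_integrable f g : L2_vector f -> L2_vector g ->
  mu.-integrable setT (fun x => (dot (f x) (g x))%:E).
Proof.
move=> Lf Lg; under eq_fun do rewrite /dot -sumEFin.
by apply: integrable_sum => // i _; exact: Lfun2M_integrable.
Qed.

Lemma L2_vectorD f g : L2_vector f -> L2_vector g -> L2_vector (f + g).
Proof.
move=> Lf Lg i; rewrite (_ : (fun _ => _) = fun x => f x i 0 + g x i 0).
  exact: Lfun2D.
by apply/funext => x; rewrite !fctE mxE.
Qed.

Lemma L2_vectorZ c f : L2_vector f -> L2_vector (c *: f).
Proof.
move=> Lf i; rewrite (_ : (fun _ => _) = fun x => c * f x i 0).
  exact: Lfun2Z.
by apply/funext => x; rewrite !fctE mxE.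
Qed.

Lemma inner_semi_inner : semi_inner (@L2_vector R d) (@inner R d).
Proof.
split.
- exact: L2_vectorD.
- exact: L2_vectorZ.
- by move=> f g _ _; apply: eq_Rintegral => x _; rewrite dotC.
- move=> f g h Lf Lg Lh; rewrite /inner -RintegralD//; try exact: dot_integrable.
  by apply: eq_Rintegral => x _; rewrite fctE dotDl.
- move=> c f h Lf Lh; rewrite /inner -RintegralZl//; try exact: dot_integrable.
  by apply: eq_Rintegral => x _; rewrite fctE dotZl.
- by move=> f _; apply: Rintegral_ge0 => x _; exact: dot_ge0.
Qed.

Lemma EFin_inner f : L2_vector f ->
  (inner f f)%:E = (\int[mu]_x (dot (f x) (f x))%:E)%E.
Proof.
by move=> Lf; rewrite /inner /Rintegral fineK//; apply: integrable_fin_num => //;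
  exact: dot_integrable.
Qed.

Lemma measurable_dot f g : (forall i, measurable_fun setT (fun x => f x i 0)) ->
  (forall i, measurable_fun setT (fun x => g x i 0)) ->
  measurable_fun setT (fun x => dot (f x) (g x)).
Proof.
by move=> mf mg; apply: measurable_sum => i; exact: measurable_funM.
Qed.

Lemma L2_vector_of_dot f : (forall i, measurable_fun setT (fun x => f x i 0)) ->
  (\int[mu]_x (dot (f x) (f x))%:E < +oo)%E -> L2_vector f.
Proof.
move=> mf fi i; apply: Lfun2P => //; apply: le_lt_trans fi.
apply: ge0_le_integral => //.
- by move=> x _; rewrite lee_fin sqr_ge0.
- by apply/measurable_EFinP; exact: measurable_funX.
- by apply/measurable_EFinP; exact: measurable_dot.
- by move=> x _; rewrite lee_fin sqr_coord_le_dot.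
Qed.

(** Riesz-Fischer: the sequence converges almost everywhere, and Fatou's lemma, applied
    to the squares of [q m - q n] as m grows, transfers the Cauchy bounds to the
    pointwise limit. *)
Lemma inner_complete : ip_complete (@L2_vector R d) (@inner R d).
Proof.
move=> q Lq qC.
have mq n i : measurable_fun setT (fun x => q n x i 0) := Lfun_measurable (Lq n i).
have LB n m : L2_vector (q m - q n) by exact: (semi_innerB inner_semi_inner).
have coord_cvg i : {ae mu, forall x, cvgn (fun n => q n x i 0)}.
  apply: ae_cvg_of_L2_geometric => // n.
  have := qC n n.+1 (leqnSn n); rewrite -lee_fin EFin_inner//.
  apply: le_trans; apply: ge0_le_integral => //.
  - by move=> x _; rewrite lee_fin sqr_ge0.
  - by apply/measurable_EFinP; apply: measurable_funX; exact: measurable_funB.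
  - by apply/measurable_EFinP; apply: measurable_dot => j;
      exact: Lfun_measurable (LB _ _ j).
  move=> x _; rewrite lee_fin; apply: le_trans (sqr_coord_le_dot _ i).
  by rewrite !fctE !mxE.
(* The upper limit is measurable without any condition on the sequence, and is the
   limit wherever there is one. *)
pose h : torus_point R d -> 'cV[R]_d := fun x =>
  \col_i fine (limn_esup (fun n => (q n x i 0)%:E)).
have mh i : measurable_fun setT (fun x => h x i 0).
  under eq_fun do rewrite mxE.
  apply: (measurableT_comp (@fine_measurable _ setT measurableT)).
  by apply: measurable_fun_limn_esup => n; exact/measurable_EFinP.
have q_h : {ae mu, forall x, forall i, (fun n => q n x i 0) @ \oo --> h x i 0}.
  have : {ae mu, forall x, forall i, cvgn (fun n => q n x i 0)}.
    exact: filter_forall.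
  apply: filterS => x cv i; have {cv} /cvg_ex[l ql] := cv i.
  rewrite mxE; have : (fun n => (q n x i 0)%:E) @ \oo --> l%:E.
    by apply/fine_cvgP; split=> //; exact: nearW.
  by move=> /cvg_limn_einf_sup[_ ->].
have mhq n i : measurable_fun setT (fun x => (h - q n) x i 0).
  under eq_fun do rewrite fctE !mxE.
  have := mh i; under eq_fun do rewrite mxE.
  by move=> mhi; exact: measurable_funB.
have fat n : (\int[mu]_x (dot ((h - q n) x) ((h - q n) x))%:E <= (4^-1 ^+ n)%:E)%E.
  pose G m x := (dot ((q m - q n) x) ((q m - q n) x))%:E.
  have mG m : measurable_fun setT (G m).
    by apply/measurable_EFinP; apply: measurable_dot => j;
      exact: Lfun_measurable (LB _ _ j).
  have G0 m x : (0 <= G m x)%E by rewrite lee_fin dot_ge0.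
  apply: (@le_trans _ _ (\int[mu]_x limn_einf (G^~ x))%E).
    apply: ae_ge0_le_integral => //.
    - by move=> x _; rewrite lee_fin dot_ge0.
    - by apply/measurable_EFinP; exact: measurable_dot.
    - move=> x _; rewrite limn_einf_lim; apply: lime_ge; first exact: is_cvg_einfs.
      by apply: nearW => m; apply: le_ereal_inf_tmp => _ [k _ <-]; exact: G0.
    - under eq_fun do rewrite -[limn_einf _]oppeK -limn_esupN.
      apply: measurableT_comp => //; apply: measurable_fun_limn_esup => m.
      exact: measurableT_comp.
    apply: filterS q_h => x qx _.
    have : G ^~ x @ \oo --> (dot ((h - q n) x) ((h - q n) x))%:E.
      apply/fine_cvgP; split; first exact: nearW.
      have cv i : (fun m => (q m - q n) x i 0) @ \oo --> (h - q n) x i 0.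
        rewrite (_ : (fun _ => _) = fun m => q m x i 0 - q n x i 0); last first.
          by apply/funext => m; rewrite !fctE !mxE.
        rewrite (_ : (h - q n) x i 0 = h x i 0 - q n x i 0) ?fctE ?mxE//.
        apply: cvgB; last exact: cvg_cst.
        by have := qx i; rewrite mxE.
      rewrite /comp/= /dot; apply: cvg_big => [|i _]; last exact: cvgM.
      exact: add_continuous.
    by move=> /cvg_limn_einf_sup[-> _].
  apply: le_trans (fatou _ _ mG _) _ => //.
  rewrite limn_einf_lim; apply: lime_le; first exact: is_cvg_einfs.
  apply: nearW => m.
  apply: (@le_trans _ _ (\int[mu]_x G (maxn m n) x)%E).
    by apply: ereal_inf_lbound; exists (maxn m n) => //=; exact: leq_maxl.
  by rewrite -EFin_inner// lee_fin qC// leq_maxr.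
have Lhq n : L2_vector (h - q n).
  by apply: L2_vector_of_dot => //; apply: le_lt_trans (fat n) _; rewrite ltry.
exists h => [|n].
  by rewrite -(subrK (q 0%N) h); exact: L2_vectorD.
by rewrite -lee_fin EFin_inner.
Qed.

End L2_vector_fields.

(** * Gradient fields form a subspace *)

Section continuous_of_coordinates.
Context (R : realType) (d : nat).
Local Notation mu := (torus_measure R d).

Lemma mem_itv_center_sym (x q r : R) : x - r < q -> q < x + r -> q - r < x /\ x < q + r.
Proof. by move=> *; split; lra. Qed.

Lemma dist_lt_common_center (x y q r e : R) : q - r < y -> y < q + r ->
  x - r < q -> q < x + r -> r < e / 2 -> `|x - y| < e.
Proof. by move=> *; rewrite ltr_norml; apply/andP; split; lra. Qed.

(** The sigma-algebra on points of the torus is the product one, so an open set has to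
    be covered by countably many boxes: those with a rational center and sides of
    length 2 / m contained in it. *)
Lemma measurable_coords_open (U : set 'rV[R]_d) :
  open U -> measurable ((@coords R d) @^-1` U).
Proof.
move=> oU.
pose box (c : 'rV[rat]_d * nat) : set (torus_point R d) :=
  [set x | forall i, tnth x i \in `]ratr (c.1 0 i) - c.2.+1%:R^-1,
                                     ratr (c.1 0 i) + c.2.+1%:R^-1[].
have mbox c : measurable (box c).
  rewrite (_ : box c = \bigcap_(i in [set: 'I_d]) ((fun x => tnth x i) @^-1`
      `]ratr (c.1 0 i) - c.2.+1%:R^-1, ratr (c.1 0 i) + c.2.+1%:R^-1[)).
    apply: fin_bigcap_measurable => // i _.
    by rewrite -[X in measurable X]setTI; exact: measurable_tnth.
  by apply/seteqP; split=> x /= h i; [move=> _|]; exact: h.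
rewrite (_ : _ @^-1` U = \bigcup_c
    (if `[< box c `<=` (@coords R d) @^-1` U >] then box c else set0)).
  apply: countable_bigcupT_measurable; first exact: countableP.
  by move=> c; case: ifP.
apply/seteqP; split=> [x Ux|x [c _]]; last by case: asboolP => // bU /bU.
have /nbhs_ballP[e /= e0 eU] := open_nbhs_nbhs (conj oU Ux).
have [n ne] : exists n : nat, n.+1%:R^-1 < e / 2.
  have e20 : 0 < e / 2 by rewrite divr_gt0.
  by have [n _ nP] := near_infty_natSinv_lt (PosNum e20); exists n; exact: nP (leqnn n).
have /choice[q qP] (i : 'I_d) : exists q : rat,
    ratr q \in `]tnth x i - n.+1%:R^-1, tnth x i + n.+1%:R^-1[.
  by apply: rat_in_itvoo; rewrite ltrD2l gtrN.
have xq : box (\row_i q i, n) x.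
  move=> i; have := qP i; rewrite !in_itv/= mxE => /andP[h1 h2].
  by apply/andP; exact: mem_itv_center_sym h1 h2.
exists (\row_i q i, n) => //; case: asboolP => // -[] y yq.
apply: eU; split=> // k i; rewrite ord1 !mxE.
have := qP i; have := yq i; rewrite !in_itv/= mxE => /andP[h1 h2] /andP[h3 h4].
exact: dist_lt_common_center h1 h2 h3 h4 ne.
Qed.

Lemma measurable_continuous_coords (eta : 'rV[R]_d -> R) :
  continuous eta -> measurable_fun setT (eta \o @coords R d).
Proof.
move=> ceta; apply: (measurability (@RGenOInfty.G R)).
  exact: RGenOInfty.measurableE.
move=> _ [_ [a ->] <-]; rewrite setTI comp_preimage.
apply: measurable_coords_open; apply: open_comp => // x _; exact: ceta.
Qed.

Lemma continuous_bounded_cube (eta : 'rV[R]_d -> R) : continuous eta ->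
  exists M, forall x, @unit_cube R d x -> `|eta (coords x)| <= M.
Proof.
move=> ceta.
have K : compact [set v : 'rV[R]_d | forall i, `[0, 1]%classic (v ord0 i)].
  apply: (@rV_compact R d (fun=> `[0, 1]%classic)) => _.
  exact: segment_compact.
have : compact (eta @` [set v : 'rV[R]_d | forall i, `[0, 1]%classic (v ord0 i)]).
  by apply: continuous_compact => //; exact: continuous_subspaceT.
move=> /compact_bounded[M [_ HM]]; exists (M + 1) => x x01.
apply: HM; first by rewrite ltrDl.
exists (coords x) => // i; rewrite /= in_itv/= mxE.
by have /andP[-> /ltW ->] := x01 i.
Qed.

Lemma integrable_L2_continuous (v : torus_point R d -> R) (eta : 'rV[R]_d -> R) :
  L2_scalar v -> continuous eta ->
  mu.-integrable setT (EFin \o (fun x => v x * eta (coords x))).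
Proof.
move=> Lv ceta; apply: Lfun2M_integrable => //.
have [M bM] := continuous_bounded_cube ceta.
rewrite (_ : (fun _ => _) = fun x => eta (coords x) * cst 1 x); last first.
  by apply/funext => x; rewrite mulr1.
apply: (@Lfun2M_ae_bounded _ _ _ _ M); last exact: Lfun_cst.
  exact: measurable_continuous_coords.
exists (~` @unit_cube R d); split.
- by apply: measurableC; exact: measurable_unit_cube.
- exact: torus_measure_unit_cubeC.
- by move=> x /=; apply: contra_not => /bM.
Qed.

(** Weak differentiation is linear because all the integrals converge: test functions
    and their derivatives are bounded on the cube. *)
Lemma gradient_field_linear (c : R) (f g : torus_point R d -> 'cV[R]_d) :
  gradient_field f -> gradient_field g -> gradient_field (f + c *: g).
Proof.
move=> [v [Lv Lf vf]] [w [Lw Lg wg]]; exists (fun x => v x + c * w x); split.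
- by apply: Lfun2D => //; exact: Lfun2Z.
- by apply: L2_vectorD => //; exact: L2_vectorZ.
move=> eta j eta_test; have [/(_ 1%N)[ceta /(_ j)[_ cDeta]] _] := eta_test.
have I1 := integrable_L2_continuous Lv cDeta.
have I2 := integrable_L2_continuous Lw cDeta.
have I3 := integrable_L2_continuous (Lf j) ceta.
have I4 := integrable_L2_continuous (Lg j) ceta.
transitivity (\int[mu]_x (v x * 'D_(delta_mx 0 j) eta (coords x)) +
    c * \int[mu]_x (w x * 'D_(delta_mx 0 j) eta (coords x))).
  rewrite -RintegralZl// -RintegralD//.
    by apply: eq_Rintegral => x _; rewrite mulrDl mulrA.
  exact: (integrableZl measurableT c I2).
rewrite vf// wg// mulrN -opprD; congr (- _).
rewrite -RintegralZl// -RintegralD//.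
  by apply: eq_Rintegral => x _; rewrite !fctE !mxE mulrDl mulrA.
exact: (integrableZl measurableT c I4).
Qed.

End continuous_of_coordinates.

(** * The coefficient field *)

Local Notation mulf := Defs.mulf.

Section coefficient_field.
Context (R : realType) (d : nat).
Variables (a : torus_point R d -> 'M[R]_d) (lambda Lambda : R).
Hypotheses (La : Linfty_matrix a) (ell : elliptic a lambda Lambda).
Hypothesis lambda_gt0 : 0 < lambda.

Lemma L2_vector_mulf f : L2_vector f -> L2_vector (mulf a f).
Proof.
move=> Lf i; under eq_fun do rewrite /mulf mxE.
apply: Lfun2_sum => j; have [M aM] := Lfun_infty_ae_bounded (La i j).
exact: Lfun2M_ae_bounded (Lfun_measurable (La i j)) aM (Lf j).
Qed.

Lemma mulfB f g : mulf a (f - g) = mulf a f - mulf a g.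
Proof. by apply/funext => x; rewrite /mulf !fctE mulmxBr. Qed.

Lemma dot_mulmx (A : 'M[R]_d) u v : dot u (A *m v) = dot (A^T *m u) v.
Proof.
rewrite /dot; under eq_bigr do rewrite mxE mulr_sumr.
rewrite exchange_big; apply: eq_bigr => j _; rewrite mxE mulr_suml.
by apply: eq_bigr => i _; rewrite mxE; ring.
Qed.

Lemma inner_mulf_lower f : L2_vector f ->
  lambda^-1 * inner f f <= inner f (mulf a f).
Proof.
move=> Lf; rewrite /inner -RintegralZl//; last exact: dot_integrable.
apply: le_Rintegral_unit_cube.
- rewrite (_ : _ \o _ = fun x => (lambda^-1%:E * (dot (f x) (f x))%:E)%E)//.
  by apply: integrableZl => //; exact: dot_integrable.
- by apply: dot_integrable => //; exact: L2_vector_mulf.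
by move=> x /ell[_ /(_ (f x)) /andP[]].
Qed.

Lemma inner_mulf_upper f : L2_vector f ->
  inner f (mulf a f) <= Lambda * inner f f.
Proof.
move=> Lf; rewrite /inner -RintegralZl//; last exact: dot_integrable.
apply: le_Rintegral_unit_cube.
- by apply: dot_integrable => //; exact: L2_vector_mulf.
- rewrite (_ : _ \o _ = fun x => (Lambda%:E * (dot (f x) (f x))%:E)%E)//.
  by apply: integrableZl => //; exact: dot_integrable.
by move=> x /ell[_ /(_ (f x)) /andP[]].
Qed.

Lemma inner_mulf_semi_inner :
  semi_inner (@L2_vector R d) (fun f g => inner f (mulf a g)).
Proof.
have I := inner_semi_inner R d; have LA := L2_vector_mulf.
split; [exact: semi_innerD I|exact: semi_innerZ I| | | | ].
- move=> f g Lf Lg; apply: eq_Rintegral_unit_cube.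
  + by apply: dot_integrable => //; exact: LA.
  + by apply: dot_integrable => //; exact: LA.
  by move=> x /ell[sym _]; rewrite /mulf dot_mulmx sym dotC.
- by move=> f g h Lf Lg /LA Lh; exact: (ipDl I).
- by move=> c f h Lf /LA Lh; exact: (ipZl I).
- move=> f Lf; apply: le_trans (inner_mulf_lower Lf).
  by rewrite mulr_ge0 ?invr_ge0 ?(ltW lambda_gt0)// (ip_ge0 I).
Qed.

End coefficient_field.

(** * The Helmholtz-Leray projector *)

Section leray_projector.
Context (R : realType) (d : nat).
Implicit Types f q : torus_point R d -> 'cV[R]_d.

Lemma gradient_field_L2 f : gradient_field f -> L2_vector f.
Proof. by move=> [v []]. Qed.

(** The choice operator in the definition of [leray] picks a projection as soon as there
    is one. *)
Lemma leray_is_projection f : L2_vector f -> is_leray_projection f (leray f).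
Proof.
move=> Lf; have [h [Lh divh] fh] := projection_exists
  (inner_semi_inner R d) (@inner_complete R d) gradient_field_L2 Lf.
rewrite /leray; case: xgetP => [? -> //|].
by move=> /(_ h) []; split => // q Lq divq; apply: fh.
Qed.

End leray_projector.

(** * The relative estimates *)

Section scaling.
Context (R : realType).

(** Here [e], [p] and [r] are the norms of the error, of P phi and of Gamma (a phi + g).
    For the last inequality, (1 + lambda Lambda) p / n is at most (1 + lambda Lambda)
    times the maximum, lambda r / n at most lambda Lambda sqrt 2 times it, and
    1 + sqrt 2 <= 2 sqrt 2. *)
Lemma estimates_of_norm_bounds (lambda Lambda n p r e : R) : 1 < lambda -> 1 < Lambda ->
  0 <= n -> 0 <= p -> 0 <= r ->
  e <= (1 + lambda * Lambda) * p + lambda * r -> p <= e -> r <= Lambda * e ->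
  [/\ e / n <= (1 + lambda * Lambda) * (p / n) + lambda * (r / n),
      Num.max (p / n) ((Lambda * Num.sqrt 2)^-1 * (r / n)) <= e / n &
      (2 * Num.sqrt 2 * (1 + lambda * Lambda))^-1 *
        ((1 + lambda * Lambda) * (p / n) + lambda * (r / n)) <=
      Num.max (p / n) ((Lambda * Num.sqrt 2)^-1 * (r / n))].
Proof.
move=> l1 L1 n0 p0 r0 up lo1 lo2.
have s1 : 1 <= Num.sqrt 2 :> R.
  by rewrite -[leLHS]sqrtr1 ler_wsqrtr// ler1n.
set s := Num.sqrt 2 in s1 *.
have ni0 : 0 <= n^-1 by rewrite invr_ge0.
have Ls0 : 0 < Lambda * s by rewrite mulr_gt0//; lra.
split.
- by rewrite !mulrA -mulrDl ler_wpM2r.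
- rewrite ge_max ler_wpM2r//= ler_pdivrMl// mulrA ler_wpM2r//.
  apply: le_trans lo2 _; rewrite mulrAC -[leLHS]mulr1 ler_wpM2l//.
  by rewrite mulr_ge0//; lra.
set x := p / n; set y := r / n; set M := Num.max _ _.
have xM : x <= M by rewrite le_max lexx.
have yM : y <= Lambda * s * M by rewrite -ler_pdivrMl// le_max lexx orbT.
have M0 : 0 <= M by apply: le_trans xM; rewrite mulr_ge0.
have lL0 : 0 < lambda * Lambda by rewrite mulr_gt0//; lra.
rewrite ler_pdivrMl; last by rewrite !mulr_gt0//; lra.
have A1 : (1 + lambda * Lambda) * x <= (1 + lambda * Lambda) * M.
  by rewrite ler_wpM2l//; lra.
have A2 : lambda * y <= lambda * (Lambda * s * M) by rewrite ler_wpM2l//; lra.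
have sM : M <= s * M by rewrite -[leLHS]mul1r ler_wpM2r.
apply: le_trans (lerD A1 A2) _.
have : (1 + lambda * Lambda) * M <= (1 + lambda * Lambda) * (s * M).
  by rewrite ler_wpM2l//; lra.
have : 0 <= s * M by rewrite mulr_ge0//; lra.
by rewrite !mulrDl !mul1r; lra.
Qed.

End scaling.

Unset Implicit Arguments.

Theorem proposition4p4 (R : realType) (d : nat)
    (g : torus_point R d -> 'cV[R]_d) (a : torus_point R d -> 'M[R]_d)
    (lambda Lambda : R) (gradu phi : torus_point R d -> 'cV[R]_d) :
  L2_vector g ->
  Linfty_matrix a ->
  1 < lambda -> 1 < Lambda ->
  elliptic a lambda Lambda ->
  is_minimizer a g gradu ->
  ~ {ae torus_measure R d, forall x, gradu x = 0} ->
  L2_vector phi ->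
  [/\ rel_err gradu phi <= E_max a g gradu phi lambda Lambda,
      E_min a g gradu phi Lambda <= rel_err gradu phi &
      (2 * Num.sqrt 2 * (1 + lambda * Lambda))^-1
        * E_max a g gradu phi lambda Lambda
      <= E_min a g gradu phi Lambda].
Proof.
move=> Lg La l1 L1 ell [gu umin] _ Lphi.
have l0 : 0 < lambda := lt_trans ltr01 l1.
have L0 : 0 <= Lambda := ltW (lt_trans ltr01 L1).
have H := inner_semi_inner R d; have HA := inner_mulf_semi_inner La ell l0.
have LA := @L2_vector_mulf _ _ _ La; have GL := @gradient_field_L2 R d.
have lo := inner_mulf_lower La ell; have up := inner_mulf_upper La ell.
have AB f h : L2_vector f -> L2_vector h -> mulf a (f - h) = mulf a f - mulf a h.
  by move=> _ _; exact: mulfB.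
have res := minimizer_residual_orthogonal H HA LA GL
  (@gradient_field_linear R d) Lg gu umin.
have [Lh dh hp] := leray_is_projection Lphi.
have Laphi : L2_vector (mulf a phi + g) := L2_vectorD (LA _ Lphi) Lg.
have [Lk dk kp] := leray_is_projection Laphi.
have hp' q : orth_compl (@L2_vector R d) (@gradient_field R d) (@inner R d) q ->
  inner (phi - leray phi) q = 0 by move=> [Lq dq]; exact: hp.
have kp' q : orth_compl (@L2_vector R d) (@gradient_field R d) (@inner R d) q ->
  inner (mulf a phi + g - leray (mulf a phi + g)) q = 0 by move=> [Lq dq]; exact: kp.
apply: estimates_of_norm_bounds => //; try exact: sqrtr_ge0.
- exact: (error_le H HA LA AB l0 L0 lo up GL Lg gu Lphi res
    (conj Lh dh) (conj Lk dk) hp').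
- exact: (projection_norm_le_error H GL gu Lphi (conj Lh dh) hp').
- exact: (residual_norm_le_error H HA LA AB L0 up GL Lg gu Lphi res (conj Lk dk) kp').
Qed.
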